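(* Let $\mathcal{L}$ be the association scheme arising from a non-degenerate $LSSD(v,k,\lambda;w)$, where $k,\lambda$ are the parameters of the $\mu$-heavy LSSD, and let $s=\sqrt{k-\lambda}$. If either $\mathcal{L}$ is optimistic, or $\mathcal{L}$ is pessimistic and $w\le 2+\frac{2(k+s)}{v-2k}$, then for every integer $t$ with $1\le t\le w$ there exists a set of $vt$ equiangular lines in $\mathbb{R}^{v+t-1}$. If $\mathcal{L}$ is pessimistic and $w>2+\frac{2(k+s)}{v-2k}$, then such a set of $vt$ equiangular lines in $\mathbb{R}^{v+t-1}$ exists for every integer $t$ with $1\le t\le 2+\frac{2(k+s)}{v-2k}$.
   Context: A symmetric $(v,k,\lambda)$-design consists of a set of $v$ points and a collection of $v$ blocks such that every block contains $k$ points, every point lies in $k$ blocks, every pair of distinct points lies in exactly $\lambda$ common blocks, and every pair of distinct blocks meets in exactly $\lambda$ points. Its incidence graph is the bipartite graph on points and blocks with a point adjacent to a block iff the point is in the block. A linked system of symmetric designs $LSSD(v,k,\lambda;w)$, $w\ge 2$, is a graph $\Gamma$ on $wv$ vertices whose vertex set $X$ is partitioned into $w$ sets (''fibers'') $X_1,\dots,X_w$ of size $v$ such that: (i) no edge has both ends in the same fiber; (ii) for all $i\ne j$, the subgraph of $\Gamma$ induced between $X_i$ and $X_j$ is the incidence graph of some symmetric $(v,k,\lambda)$-design; (iii) there are constants $\mu,\nu$ such that for all distinct $h,i,j$ and all $a\in X_i$, $b\in X_j$, the number of common neighbours of $a$ and $b$ lying in $X_h$ is $\mu$ if $a\sim b$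 and $\nu$ if $a\not\sim b$. It is non-degenerate if $1<k<v-1$. The multipartite complement of $\Gamma$ is obtained by swapping adjacency and non-adjacency between vertices in distinct fibers. For $w\ge3$ exactly one of $\Gamma$ and its multipartite complement is $\mu$-heavy, meaning $\mu>\nu$; by convention $k,\lambda$ are the parameters of the $\mu$-heavy one. For $w=2$ either of the two may be chosen to play this role. The association scheme $\mathcal{L}$ arising from the LSSD has relations: $R_0$ identity; $R_1$ adjacency in the $\mu$-heavy LSSD; $R_2$ distinct vertices in the same fiber; $R_3$ adjacency in its multipartite complement. $\mathcal{L}$ is optimistic if the valency $k(w-1)$ of $R_1$ exceeds the valency $(v-k)(w-1)$ of $R_3$, i.e. $2k>v$, and pessimistic if $2k<v$. Equiangular lines are (distinct) lines through the origin such that all pairs of distinct lines make the same angle. *)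

(* Defs.v *)
From HB Require Import structures.
From mathcomp Require Import all_boot all_order all_algebra.
From mathcomp Require Import boolp classical_sets functions cardinality reals trigo.

Set Implicit Arguments.
Unset Strict Implicit.
Unset Printing Implicit Defensive.

Import Order.TTheory GRing.Theory Num.Theory.

Record symmetric_design (P B : finType) (inc : P -> B -> bool)
    (v k lam : nat) : Prop := SymmetricDesign {
  sd_points : #|P| = v;
  sd_blocks : #|B| = v;
  sd_block_size : forall b : B, #|[set p : P | inc p b]| = k;
  sd_point_deg : forall p : P, #|[set b : B | inc p b]| = k;
  sd_point_pair : forall p q : P, p != q ->
    #|[set b : B | inc p b && inc q b]| = lam;
  sd_block_pair : forall b c : B, b != c ->
    #|[set p : P | inc p b && inc p c]| = lam
}.

Definition fiber (X : finType) (w : nat) (fib : X -> 'I_w) (i : 'I_w) : finType :=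
  {x : X | fib x == i}.

(* [fib x] is the index of the fiber containing [x]. In [lssd_design] the points
   are the vertices of fiber i and the blocks those of fiber j. For w = 2 the
   condition [lssd_common] is vacuous and mu, nu are unconstrained. *)
Record LSSD (X : finType) (w : nat) (fib : X -> 'I_w) (adj : rel X)
    (v k lam mu nu : nat) : Prop := IsLSSD {
  lssd_fibers_ge2 : 2 <= w;
  lssd_sym : symmetric adj;
  lssd_fiber_size : forall i : 'I_w, #|fiber fib i| = v;
  lssd_fiber_indep : forall x y : X, fib x = fib y -> ~~ adj x y;
  lssd_design : forall i j : 'I_w, i != j ->
    symmetric_design (fun (x : fiber fib i) (y : fiber fib j) => adj (val x) (val y))
      v k lam;
  lssd_common : forall (h i j : 'I_w) (a b : X),
    h != i -> h != j -> i != j -> fib a = i -> fib b = j ->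
    #|[set c : X | [&& fib c == h, adj a c & adj b c]]| =
      if adj a b then mu else nu
}.

Definition nondegenerate_lssd (v k : nat) : Prop := 1 < k /\ k < v - 1.

(* For w = 2 either of the graph and its multipartite complement may be chosen
   to play the role of the mu-heavy system, hence no condition. *)
Definition mu_heavy (w mu nu : nat) : Prop := 3 <= w -> nu < mu.

Definition multipartite_complement (X : finType) (w : nat) (fib : X -> 'I_w)
    (adj : rel X) : rel X :=
  fun x y => (fib x != fib y) && ~~ adj x y.

(* [adj] is meant to be the mu-heavy graph. *)
Definition lssd_scheme (X : finType) (w : nat) (fib : X -> 'I_w) (adj : rel X)
    (i : 'I_4) : rel X :=
  match val i with
  | 0 => fun x y => x == y
  | 1 => adj
  | 2 => fun x y => (x != y) && (fib x == fib y)
  | _ => multipartite_complement fib adj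
  end.

Definition scheme_R1 (X : finType) (scheme : 'I_4 -> rel X) : rel X :=
  scheme (@Ordinal 4 1 isT).
Definition scheme_R3 (X : finType) (scheme : 'I_4 -> rel X) : rel X :=
  scheme (@Ordinal 4 3 isT).

(* The valency of a relation of the scheme is its out-degree at any vertex: for
   an LSSD it is k(w-1) for R_1 and (v-k)(w-1) for R_3, so these two conditions
   say 2k > v and 2k < v, respectively. *)
Definition optimistic (X : finType) (scheme : 'I_4 -> rel X) : Prop :=
  forall x : X, #|[set y | scheme_R3 scheme x y]| < #|[set y | scheme_R1 scheme x y]|.
Definition pessimistic (X : finType) (scheme : 'I_4 -> rel X) : Prop :=
  forall x : X, #|[set y | scheme_R1 scheme x y]| < #|[set y | scheme_R3 scheme x y]|.

Local Open Scope ring_scope.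

(* Written out by hand because the library norm on matrices is the sup norm. *)
Definition dotp (R : realType) (d : nat) (u v : 'rV[R]_d) : R :=
  \sum_(i < d) u 0 i * v 0 i.
Definition enorm (R : realType) (d : nat) (u : 'rV[R]_d) : R :=
  Num.sqrt (dotp u u).

(* The angle, in [0, pi/2], between the lines spanned by nonzero u and v. *)
Definition line_angle (R : realType) (d : nat) (u v : 'rV[R]_d) : R :=
  acos (`|dotp u v| / (enorm u * enorm v)).

Definition equiangular_lines (R : realType) (d : nat)
    (S : set {vspace 'rV[R]_d}) : Prop :=
  (forall L, S L -> \dim L = 1%N) /\
  exists theta : R, forall L M, S L -> S M -> L <> M ->
    forall u v, u \in L -> v \in M -> u != 0 -> v != 0 -> line_angle u v = theta.

Definition exists_equiangular (R : realType) (n d : nat) : Prop :=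
  exists S : set {vspace 'rV[R]_d},
    card_eq S [set i : nat | (i < n)%N]%classic /\ equiangular_lines S.

(* Main.v *)
Require Import Defs.
From HB Require Import structures.
From mathcomp Require Import all_boot all_order all_algebra.
From mathcomp Require Import boolp classical_sets functions cardinality reals trigo.
From mathcomp Require Import ring lra.

Set Implicit Arguments.
Unset Strict Implicit.
Unset Printing Implicit Defensive.

Import Order.TTheory GRing.Theory Num.Theory.
Local Open Scope ring_scope.

(** The Gram matrix of the lines is prescribed on the union Y of t fibers: with A
    the adjacency relation and s = sqrt (k - lam), it has diagonal entries
    1 + 2 s, entries 1 inside a fiber, and 2 A x y - 1 between distinct fibers.
    All off-diagonal entries are 1 or -1, and s > 0, so vectors with these inner
    products span distinct lines at the common angle acos (1 / (1 + 2 s)). What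
    has to be shown is that such vectors exist in dimension v + t - 1, that is,
    that the matrix is positive semidefinite of rank at most v + t - 1.

    The association scheme is used without its spectral theory, through one
    explicit kernel K, equal to s (I - J / v) inside a fiber and to A - k / v
    between fibers. Design counting gives that K sums to zero along every fiber,
    and that K restricted to the columns of any single fiber reproduces K:
    sum_(y in fiber h) K x y K z y = s K x z ([kernel_reproducing]). For three
    distinct fibers this needs mu - nu = s, which comes from counting the paths
    a ~ x ~ y ~ b that visit three fibers ([mu_nu]). Hence
    K is s^-1 times a Gram matrix of zero-sum vectors indexed by one fiber, which
    live in dimension v - 1 ([drop_coordinate]).

    The prescribed matrix is 2 K plus a matrix that depends on the fibers only,
    with value p = 1 + 2 s / v inside a fiber and q = 2 k / v - 1 between fibers.
    That t by t matrix has eigenvalues p - q > 0 and p + (t - 1) q, so it is the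
    Gram matrix of t vectors in dimension t as soon as
    2 s + v + (t - 1) (2 k - v) >= 0 ([equicorrelated_vectors]). This holds for
    every t when 2 k > v, and means t <= 2 + 2 (k + s) / (v - 2 k) when 2 k < v.
    The dimensions add up to (v - 1) + t. *)

(** * Lines from a Gram matrix *)

Lemma card_eq_finset (X : finType) (A : {set X}) :
  card_eq [set x | x \in A]%classic [set i : nat | (i < #|A|)%N]%classic.
Proof.
have [A0|/set0Pn[x0 _]] := eqVneq A finset.set0.
  rewrite A0 cards0.
  have -> : [set x : X | x \in (finset.set0 : {set X})]%classic = set0%classic.
    by apply/seteqP; split => x //=; rewrite inE.
  have -> : [set i : nat | (i < 0)%N]%classic = set0%classic.
    by apply/seteqP; split => x.
  by rewrite card_eq0.
have -> : [set x | x \in A]%classic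
    = [set nth x0 (enum A) i | i in [set i : nat | (i < #|A|)%N]]%classic.
  apply/seteqP; split => x /=.
    move=> xA; exists (index x (enum A)).
      by rewrite /= cardE index_mem mem_enum.
    by rewrite nth_index // mem_enum.
  by case=> i; rewrite /= cardE => lti <-; rewrite -mem_enum mem_nth.
apply: inj_card_eq => i j; rewrite !inE /= !cardE => lti ltj /eqP.
by rewrite nth_uniq ?enum_uniq // => /eqP.
Qed.

Section Dotp.
Context {R : realType} {d : nat}.
Implicit Types (u v : 'rV[R]_d) (c : R).

Lemma dotpZ c1 c2 u v : dotp (c1 *: u) (c2 *: v) = c1 * c2 * dotp u v.
Proof. by rewrite /dotp mulr_sumr; apply: eq_bigr => i _; rewrite !mxE; ring. Qed.

Lemma line_angleZ c1 c2 u v : c1 != 0 -> c2 != 0 ->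
  line_angle (c1 *: u) (c2 *: v) = line_angle u v.
Proof.
move=> c10 c20; rewrite /line_angle /enorm !dotpZ -!expr2.
rewrite (sqrtrM _ (sqr_ge0 c1)) (sqrtrM _ (sqr_ge0 c2)) !sqrtr_sqr !normrM.
congr acos.
have -> : `|c1| * Num.sqrt (dotp u u) * (`|c2| * Num.sqrt (dotp v v))
   = `|c1| * `|c2| * (Num.sqrt (dotp u u) * Num.sqrt (dotp v v)) by ring.
by rewrite -mulf_div divff ?mul1r // mulf_neq0 // normr_eq0.
Qed.

End Dotp.

(** The coordinates are indexed by an arbitrary finite set D, so that a direct
    sum of coordinate spaces needs no renumbering. Two lines cannot coincide
    since the Cauchy-Schwarz inequality is strict: b < a. *)
Lemma equiangular_of_gram (R : realType) (X T : finType) (A : {set X})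
    (D : {set T}) (f : X -> T -> R) (a b : R) :
  0 <= b -> b < a ->
  {in A, forall x, \sum_(z in D) f x z * f x z = a} ->
  {in A &, forall x y, x != y -> `|\sum_(z in D) f x z * f y z| = b} ->
  exists_equiangular R #|A| #|D|.
Proof.
move=> b0 ba faa fab.
have a0 : 0 < a by exact: le_lt_trans ba.
pose u x : 'rV[R]_#|D| := \row_e f x (enum_val e).
have dotE x y : dotp (u x) (u y) = \sum_(z in D) f x z * f y z.
  by rewrite big_enum_val; apply: eq_bigr => e _; rewrite !mxE.
have u0 x : x \in A -> u x != 0.
  move=> xA; apply: contraTneq a0 => ux0; rewrite -(faa _ xA) -dotE ux0 /dotp.
  by rewrite big1 ?ltxx // => i _; rewrite mxE mul0r.
have uinj : {in A &, injective (fun x => <[u x]>%VS)}.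
  move=> x y xA yA /= exy; apply/eqP; apply: contraT => nxy.
  have /vlineP[c uxc] : u x \in <[u y]>%VS by rewrite -exy memv_line.
  have e1 : c * c * a = a.
    by rewrite -[in LHS](faa _ yA) -dotE -dotpZ -uxc dotE faa.
  have e2 : `|c * a| = b.
    rewrite -(fab _ _ xA yA nxy) -dotE uxc -[X in dotp _ X]scale1r dotpZ mulr1.
    by rewrite dotE faa.
  have : c ^+ 2 = 1 by apply: (mulIf (lt0r_neq0 a0)); rewrite expr2 e1 mul1r.
  move/(congr1 Num.sqrt); rewrite sqrtr_sqr sqrtr1 => c1.
  by move: ba; rewrite -e2 normrM c1 mul1r gtr0_norm // ltxx.
exists [set <[u x]>%VS | x in [set x | x \in A]]%classic; split.
  apply: card_eq_trans (card_eq_finset A); apply: inj_card_eq => x y.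
  by rewrite !inE /=; exact: uinj.
split=> [_ [x /= xA <-]|]; first by rewrite dim_vline u0.
exists (acos (b / a)) => _ _ [x /= xA <-] [y /= yA <-] nxy.
move=> _ _ /vlineP[c1 ->] /vlineP[c2 ->] n1 n2.
have c10 : c1 != 0 by apply: contraNneq n1 => ->; rewrite scale0r.
have c20 : c2 != 0 by apply: contraNneq n2 => ->; rewrite scale0r.
rewrite line_angleZ // /line_angle /enorm !dotE !faa // fab //.
  by rewrite -expr2 sqr_sqrtr // ltW.
by apply: contra_not_neq nxy => ->.
Qed.

(** The zero-sum hyperplane of R^F is isometric to a coordinate space with one
    coordinate fewer. The isometry subtracts c times the dropped coordinate from
    the others; on the hyperplane this changes the inner product by
    (2 c + c ^ 2 (#|F| - 1) - 1) g x0 h x0, and the chosen c makes this vanish. *)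
Lemma drop_coordinate (R : realType) (X : finType) (F : {set X}) (x0 : X)
    (g h : X -> R) (c := (1 + Num.sqrt #|F|%:R)^-1) :
  x0 \in F -> \sum_(x in F) g x = 0 -> \sum_(x in F) h x = 0 ->
  \sum_(x in F :\ x0) (g x - c * g x0) * (h x - c * h x0)
    = \sum_(x in F) g x * h x.
Proof.
move=> x0F; rewrite !(big_setD1 x0 x0F) /= => g0 h0.
set r := Num.sqrt #|F|%:R in c *.
have r0 : 0 <= r by exact: sqrtr_ge0.
have cardD : #|F :\ x0|%:R = r ^+ 2 - 1.
  by rewrite sqr_sqrtr ?ler0n // (cardsD1 x0 F) x0F natrD addrAC subrr add0r.
rewrite (eq_bigr (fun x => g x * h x - c * h x0 * g x - c * g x0 * h x
    + c ^+ 2 * g x0 * h x0)); last by move=> x _; ring.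
rewrite !big_split /= !sumrN -!mulr_sumr sumr_const -mulr_natr cardD.
have -> : \sum_(i in F :\ x0) g i = - g x0 by lra.
have -> : \sum_(i in F :\ x0) h i = - h x0 by lra.
have nz : 1 + r != 0 by rewrite gt_eqF //; lra.
by rewrite /c; field.
Qed.

(** The matrix (p - q) I + q J of size t has eigenvalues p - q and p + (t - 1) q;
    the vectors are the rows al I + be J of its symmetric square root, where al
    and ga = al + t be are the square roots of these two eigenvalues. *)
Lemma equicorrelated_vectors (R : rcfType) (t : nat) (p q : R) :
  (0 < t)%N -> q <= p -> 0 <= p + (t%:R - 1) * q ->
  exists g : nat -> 'I_t -> R, forall m n, (m < t)%N -> (n < t)%N ->
    \sum_i g m i * g n i = if m == n then p else q.
Proof.
move=> t0 qp pq; have tn0 : t%:R != 0 :> R by rewrite pnatr_eq0 -lt0n.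
pose al := Num.sqrt (p - q); pose ga := Num.sqrt (p + (t%:R - 1) * q).
have al2 : al ^+ 2 = p - q by rewrite sqr_sqrtr // subr_ge0.
have ga2 : ga ^+ 2 = p + (t%:R - 1) * q by rewrite sqr_sqrtr.
pose be := (ga - al) / t%:R.
have be2 : t%:R * be ^+ 2 + 2 * al * be = q.
  have -> : t%:R * be ^+ 2 + 2 * al * be = (ga ^+ 2 - al ^+ 2) / t%:R.
    by rewrite /be; field.
  by rewrite ga2 al2; field.
exists (fun (m : nat) (i : 'I_t) => be + al * (m == i)%:R) => m n mt nt.
have delta (l : nat) (F : 'I_t -> R) (lt : (l < t)%N) :
    \sum_(i < t) (l == i)%:R * F i = F (Ordinal lt).
  rewrite (bigD1 (Ordinal lt)) //= eqxx mul1r big1 ?addr0 // => i.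
  by rewrite -val_eqE /= eq_sym => /negbTE ->; rewrite mul0r.
rewrite (eq_bigr (fun i : 'I_t => be ^+ 2 + (m == i)%:R * (al * be)
   + (n == i)%:R * (al * be) + (m == i)%:R * (al ^+ 2 * (n == i)%:R)));
  last by move=> i _; ring.
rewrite !big_split /= sumr_const card_ord (delta m _ mt) (delta n _ nt).
rewrite (delta m (fun i : 'I_t => al ^+ 2 * (n == i)%:R) mt) /= eq_sym.
rewrite -[be ^+ 2 *+ t]mulr_natl; case: eqP => _.
  by rewrite mulr1 al2; lra.
by rewrite mulr0; lra.
Qed.

(** * Counting in a linked system *)

Section LinkedSystem.
Context {R : realType} {X : finType} {w : nat} {fib : X -> 'I_w} {adj : rel X}.
Context {v k lam mu nu : nat}.
Hypothesis hlssd : LSSD fib adj v k lam mu nu.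
Hypothesis hnondeg : nondegenerate_lssd v k.

Local Notation A x y := ((adj x y)%:R : R).

Lemma card_fiberE h (P : pred X) :
  #|[set b : fiber fib h | P (val b)]|%:R
    = \sum_(c | fib c == h) (P c)%:R :> R.
Proof.
rewrite -sum1_card natr_sum (big_sub [pred c | fib c == h]) /=.
rewrite [LHS]big_mkcond /=; apply: eq_bigr => b _.
by rewrite inE; case: (P _).
Qed.

Lemma adjC x y : A x y = A y x.
Proof. by rewrite (lssd_sym hlssd). Qed.

Lemma adj_idem x y : A x y * A x y = A x y.
Proof. by case: (adj x y); rewrite ?mulr1 ?mul0r. Qed.

Lemma sum_fiber1 h : \sum_(c | fib c == h) 1 = v%:R :> R.
Proof.
by rewrite sumr_const -(lssd_fiber_size hlssd h) card_sig.
Qed.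

Lemma sum_adj a h : fib a != h -> \sum_(c | fib c == h) A a c = k%:R.
Proof.
move=> nah; have := sd_point_deg (lssd_design hlssd nah) (exist _ a (eqxx _)).
by move=> /= <-; rewrite (card_fiberE h (adj a)).
Qed.

Lemma sum_adj2_same a b h : fib a = fib b -> fib a != h ->
  \sum_(c | fib c == h) A a c * A b c
    = lam%:R + (k%:R - lam%:R) * (a == b)%:R.
Proof.
move=> eab nah; have [<-|nab] := eqVneq a b.
  under eq_bigr do rewrite adj_idem.
  by rewrite sum_adj // mulr1 addrC subrK.
rewrite mulr0 addr0.
have eb : fib b == fib a by rewrite eab.
have := @sd_point_pair _ _ _ _ _ _ (lssd_design hlssd nah)
  (exist _ a (eqxx _)) (exist _ b eb) nab.
move=> /= <-; rewrite (card_fiberE h (fun c => adj a c && adj b c)).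
by apply: eq_bigr => c _; rewrite -natrM mulnb.
Qed.

Lemma sum_adj2_distinct a b h : fib a != h -> fib b != h -> fib a != fib b ->
  \sum_(c | fib c == h) A a c * A b c = nu%:R + (mu%:R - nu%:R) * A a b.
Proof.
move=> nah nbh nab; rewrite eq_sym in nah; rewrite eq_sym in nbh.
have := lssd_common hlssd nah nbh nab erefl erefl.
transitivity (#|[set c | [&& fib c == h, adj a c & adj b c]]|%:R : R).
  rewrite -sum1_card natr_sum big_mkcond [RHS]big_mkcond.
  apply: eq_bigr => c _; rewrite inE.
  by case: (fib c == h) => //; case: (adj a c); case: (adj b c); rewrite ?mulr1 ?mulr0.
by rewrite H; case: (adj a b); rewrite ?mulr1 ?mulr0 ?addr0 // addrC subrK.
Qed.

Lemma v_gt0 : 0 < v%:R :> R.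
Proof.
rewrite ltr0n; case: hnondeg => _ kv.
exact: leq_trans (leq_ltn_trans (leq0n k) kv) (leq_subr 1 v).
Qed.

Lemma fiber_inhabited h : exists a, fib a = h.
Proof.
have : (0 < #|fiber fib h|)%N by rewrite (lssd_fiber_size hlssd) -(ltr0n R) v_gt0.
by case/card_gt0P => -[a /eqP ah] _; exists a.
Qed.

Lemma sum_delta a h (F : X -> R) : fib a = h ->
  \sum_(c | fib c == h) (a == c)%:R * F c = F a.
Proof.
move=> ah; rewrite (bigD1 a) ?ah //= eqxx mul1r big1 ?addr0 // => c /andP[_].
by rewrite eq_sym => /negbTE ->; rewrite mul0r.
Qed.

(** The design identity k (k - 1) = lam (v - 1), obtained by counting pairs of
    points of fiber i on the blocks of fiber h through a. *)
Lemma block_size_sqr : k%:R ^+ 2 = k%:R - lam%:R + lam%:R * v%:R :> R.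
Proof.
have w2 := lssd_fibers_ge2 hlssd.
pose i := Ordinal (ltnW w2); pose h := Ordinal w2.
have [a ai] := fiber_inhabited i.
have nih : i != h by [].
transitivity (\sum_(b | fib b == i) \sum_(c | fib c == h) A a c * A b c).
  rewrite exchange_big /= (eq_bigr (fun c => A a c * k%:R)).
    by rewrite -mulr_suml sum_adj ?ai // expr2.
  move=> c /eqP ch; rewrite -mulr_sumr; congr (_ * _).
  rewrite -(@sum_adj c i); last by rewrite ch eq_sym.
  by apply: eq_bigr => b _; rewrite adjC.
rewrite (eq_bigr (fun b => lam%:R * 1 + (a == b)%:R * (k%:R - lam%:R))); last first.
  by move=> b /eqP bi; rewrite sum_adj2_same ?ai // mulr1 [_%:R * _]mulrC.
by rewrite big_split /= -mulr_sumr sum_fiber1 sum_delta // addrC.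
Qed.

Lemma size_bounds : 1 < k%:R :> R /\ k%:R + 1 < v%:R :> R.
Proof.
case: hnondeg => k1 kv; rewrite ltr1n natr1 ltr_nat; split => //.
by move: kv; rewrite ltn_subRL add1n.
Qed.

(** Because lam (v - 1) = k (k - 1) < k (v - 1), by non-degeneracy. *)
Lemma lam_lt_k : lam%:R < k%:R :> R.
Proof.
have [k1 kv] := size_bounds; have e := block_size_sqr.
by rewrite ltNge; apply/negP => kl; nra.
Qed.

Local Notation s := (Num.sqrt (k%:R - lam%:R) : R).

Lemma sqr_s : s ^+ 2 = k%:R - lam%:R.
Proof. by rewrite sqr_sqrtr // subr_ge0 ltW // lam_lt_k. Qed.

Lemma s_gt0 : 0 < s.
Proof. by rewrite sqrtr_gt0 subr_gt0 lam_lt_k. Qed.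

(** Paths a ~ x ~ y ~ b with a in fiber i, y in fiber h and x, b in fiber j are
    counted by splitting at x or at y. Comparing both counts shows that
    ((k - lam) - (mu - nu) ^ 2) A a b does not depend on b in fiber j. As a has
    both neighbours and non-neighbours there, the coefficient is zero. *)
Lemma mu_nu_sqr (i j h : 'I_w) : i != j -> j != h -> i != h ->
  (mu%:R - nu%:R) ^+ 2 = k%:R - lam%:R :> R.
Proof.
move=> nij njh nih; have [a ai] := fiber_inhabited i.
pose m : R := mu%:R - nu%:R.
pose D : R := k%:R - lam%:R - m ^+ 2.
pose C : R := nu%:R * k%:R + m * nu%:R - lam%:R * k%:R.
have walk b : fib b = j -> D * A a b = C.
  move=> bj.
  have : \sum_(x | fib x == j) A a x * \sum_(y | fib y == h) A x y * A b y
    = \sum_(y | fib y == h) A b y * \sum_(x | fib x == j) A a x * A y x.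
    under eq_bigr do rewrite mulr_sumr.
    rewrite exchange_big /=; apply: eq_bigr => y _; rewrite mulr_sumr.
    by apply: eq_bigr => x _; rewrite (adjC y x); ring.
  rewrite (eq_bigr (fun x => lam%:R * A a x
      + (b == x)%:R * ((k%:R - lam%:R) * A a x))); last first.
    move=> x /eqP xj; rewrite sum_adj2_same ?xj ?bj // eq_sym; ring.
  rewrite big_split /= -mulr_sumr sum_adj ?ai // sum_delta //.
  rewrite (eq_bigr (fun y => nu%:R * A b y + m * (A a y * A b y))); last first.
    move=> y /eqP yh; rewrite sum_adj2_distinct ?yh ?ai // 1?eq_sym //.
    rewrite -/m; ring.
  rewrite big_split /= -!mulr_sumr sum_adj ?bj // sum_adj2_distinct ?ai ?bj //.
  rewrite -/m /D /C => e; lra.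
have nai : fib a != j by rewrite ai.
(* Were D nonzero, a 0-1 valued function would be constant on fiber j; its first
   two moments e1 and e2 then force k (v - k) = 0. *)
have e1 : D * k%:R = C * v%:R.
  rewrite -(sum_adj nai) -(sum_fiber1 j) !mulr_sumr.
  by apply: eq_bigr => b /eqP bj; rewrite walk // mulr1.
have e2 : D ^+ 2 * k%:R = C ^+ 2 * v%:R.
  rewrite -(sum_adj nai) -(sum_fiber1 j) !mulr_sumr.
  apply: eq_bigr => b /eqP bj; rewrite -(walk b bj) mulr1.
  by rewrite exprMn [A a b ^+ 2]expr2 adj_idem.
have [k1 kv] := size_bounds.
have : D ^+ 2 * (k%:R * (v%:R - k%:R)) = 0.
  have -> : D ^+ 2 * (k%:R * (v%:R - k%:R)) = D ^+ 2 * k%:R * v%:R - (D * k%:R) ^+ 2 by ring.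
  by rewrite e1 e2; ring.
move/eqP; rewrite mulf_eq0 sqrf_eq0 mulf_eq0 /D subr_eq0.
case/orP => [/eqP <- //|/orP[] /eqP]; lra.
Qed.

Lemma mu_nu (i j h : 'I_w) : mu_heavy w mu nu ->
  i != j -> j != h -> i != h -> mu%:R - nu%:R = s.
Proof.
move=> heavy nij njh nih; rewrite -(mu_nu_sqr nij njh nih) sqrtr_sqr ger0_norm //.
rewrite subr_ge0 ler_nat ltnW // heavy //.
have : (#|[set i; j; h]%SET| <= #|'I_w|)%N by exact: max_card.
by rewrite card_ord finset.setUC cardsU1 cards2 !inE negb_or nij eq_sym nih eq_sym njh.
Qed.

(** * The reproducing kernel *)

(** Divided by s w, this is a primitive idempotent of rank v - 1 of the
    association scheme. *)
Definition kernel x y : R :=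
  if fib x == fib y then s * ((x == y)%:R - v%:R^-1) else A x y - k%:R / v%:R.

Lemma kernelC x y : kernel x y = kernel y x.
Proof. by rewrite /kernel (eq_sym (fib x)) (eq_sym x) adjC. Qed.

Lemma sum_kernel a h (F : X -> R) : fib a = h ->
  \sum_(y | fib y == h) kernel a y * F y
    = s * F a - s / v%:R * \sum_(y | fib y == h) F y.
Proof.
move=> ah; rewrite (eq_bigr (fun y => (a == y)%:R * (s * F y)
  - s / v%:R * F y)); last first.
  by move=> y /eqP yh; rewrite /kernel ah yh eqxx; ring.
by rewrite big_split /= sumrN -mulr_sumr sum_delta.
Qed.

Lemma sum_kernel_eq0 a h : \sum_(y | fib y == h) kernel a y = 0.
Proof.
have v0 : v%:R != 0 :> R by rewrite gt_eqF // v_gt0.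
have [ah|nah] := eqVneq (fib a) h.
  have := sum_kernel (fun=> 1) ah; rewrite sum_fiber1.
  by under eq_bigr do rewrite mulr1; move=> ->; field.
rewrite (eq_bigr (fun y => A a y - k%:R / v%:R * 1)); last first.
  by move=> y /eqP yh; rewrite /kernel yh (negbTE nah) mulr1.
by rewrite big_split /= sumrN -mulr_sumr sum_adj // sum_fiber1; field.
Qed.

(** When a or b lies in fiber h, the kernel acts there as s times the projection
    onto zero-sum functions, which fixes the other factor. Otherwise the products
    A a y A b y are counted by lam or by mu and nu; the constants match because
    k ^ 2 = s ^ 2 + lam v = k s + nu v. *)
Lemma kernel_reproducing a b h : mu_heavy w mu nu ->
  \sum_(y | fib y == h) kernel a y * kernel b y = s * kernel a b.
Proof.
move=> heavy; have v0 : v%:R != 0 :> R by rewrite gt_eqF // v_gt0.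
have [ah|nah] := eqVneq (fib a) h.
  by rewrite sum_kernel // sum_kernel_eq0 mulr0 subr0 kernelC.
have [bh|nbh] := eqVneq (fib b) h.
  under eq_bigr do rewrite mulrC.
  by rewrite sum_kernel // sum_kernel_eq0 mulr0 subr0.
rewrite (eq_bigr (fun y => A a y * A b y - k%:R / v%:R * A a y
   - k%:R / v%:R * A b y + k%:R ^+ 2 / v%:R ^+ 2 * 1)); last first.
  move=> y /eqP yh; rewrite /kernel yh (negbTE nah) (negbTE nbh).
  by field.
rewrite !big_split /= !sumrN -!mulr_sumr !sum_adj // sum_fiber1.
have kk := block_size_sqr; have ss := sqr_s.
rewrite /kernel; have [ab|nab] := eqVneq (fib a) (fib b).
  rewrite sum_adj2_same //; set s0 := s in ss *.
  have -> : lam%:R = (k%:R ^+ 2 - s0 ^+ 2) / v%:R :> R by rewrite ss kk; field.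
  have -> : k%:R - (k%:R ^+ 2 - s0 ^+ 2) / v%:R = s0 ^+ 2 by rewrite ss kk; field.
  by field.
rewrite sum_adj2_distinct // (mu_nu heavy nab nbh nah).
have -> : nu%:R = (k%:R ^+ 2 - k%:R * s) / v%:R :> R.
  have e : \sum_(y | fib y == h) \sum_(x | fib x == fib b) A a x * A y x = k%:R ^+ 2.
    rewrite exchange_big /= (eq_bigr (fun x => A a x * k%:R)).
      by rewrite -mulr_suml sum_adj // expr2.
    move=> x /eqP xb; rewrite -mulr_sumr; congr (_ * _).
    rewrite -(@sum_adj x h) ?xb //.
    by apply: eq_bigr => y _; rewrite adjC.
  rewrite -e (eq_bigr (fun y => nu%:R * 1 + s * A a y)).
    by rewrite big_split /= -!mulr_sumr sum_fiber1 sum_adj //; field.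
  move=> y /eqP yh; rewrite sum_adj2_distinct ?yh // 1?eq_sym //.
  by rewrite mulr1 (mu_nu heavy nab nbh nah).
by field.
Qed.

(** * The equiangular lines *)

(** The first t fibers are used. The vector of x consists of the rescaled row
    of the kernel at x in the reference fiber o, with the coordinate x0 removed
    isometrically, followed by the vector of the fiber of x in R^t. The factor
    sqrt (2 / s) turns the reproducing identity into an inner product 2 K. *)
Lemma lssd_equiangular (t : nat) : mu_heavy w mu nu -> (1 <= t <= w)%N ->
  0 <= 2 * s + v%:R + (t%:R - 1) * (2 * k%:R - v%:R) ->
  exists_equiangular R (v * t) (v + t - 1).
Proof.
move=> heavy /andP[t1 tw] hpsd.
have [k1 kv] := size_bounds; have s0 := s_gt0; have v0 := v_gt0.
have vn0 : v%:R != 0 :> R by rewrite gt_eqF.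
pose p : R := 1 + 2 * s / v%:R; pose q : R := 2 * k%:R / v%:R - 1.
have qp : q <= p.
  rewrite -subr_ge0 (_ : p - q = 2 * (v%:R - k%:R + s) / v%:R).
    by rewrite divr_ge0 ?ler0n //; lra.
  by rewrite /p /q; field.
have pq : 0 <= p + (t%:R - 1) * q.
  rewrite (_ : _ + _ = (2 * s + v%:R + (t%:R - 1) * (2 * k%:R - v%:R)) / v%:R).
    by rewrite divr_ge0 ?ler0n.
  by rewrite /p /q; field.
have [g gE] := equicorrelated_vectors t1 qp pq.
pose o := Ordinal (leq_trans t1 tw); have [x0 x0o] := fiber_inhabited o.
pose F := [set y | fib y == o]%SET.
have cardF : #|F| = v.
  by rewrite -(lssd_fiber_size hlssd o) card_sig; apply: eq_card => y; rewrite inE.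
have x0F : x0 \in F by rewrite inE x0o.
pose D := [set z : X + 'I_t | if z is inl y then y \in F :\ x0 else true]%SET.
have sumD (S : Type) (e : S) (op : Monoid.com_law e) (G : X + 'I_t -> S) :
    \big[op/e]_(z in D) G z
    = op (\big[op/e]_(y in F :\ x0) G (inl y)) (\big[op/e]_(i < t) G (inr i)).
  by rewrite big_sumType; congr (op _ _); apply: eq_bigl => z; rewrite inE.
have cardD : #|D| = (v + t - 1)%N.
  have vF : v = #|F :\ x0|.+1 by rewrite -cardF (cardsD1 x0 F) x0F.
  by rewrite -sum1_card sumD /= !sum1_card card_ord [in RHS]vF addSn subn1.
pose Y := [set x | fib x < t]%N%SET.
have cardY : #|Y| = (v * t)%N.
  rewrite -sum1_card (partition_big fib (fun h : 'I_w => h < t)%N) /=; last first.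
    by move=> x; rewrite inE.
  rewrite (eq_bigr (fun=> v)); last first.
    move=> h ht; rewrite sum1_card -(lssd_fiber_size hlssd h) card_sig.
    apply: eq_card => x; rewrite unfold_in /= !inE.
    by case: eqP => [->|]; rewrite ?ht ?andbF.
  by rewrite (big_ord_narrow tw) sum_nat_const card_ord mulnC.
pose c : R := (1 + Num.sqrt #|F|%:R)^-1.
pose f x (z : X + 'I_t) : R := match z with
  | inl y => Num.sqrt (2 / s) * (kernel x y - c * kernel x x0)
  | inr i => g (fib x) i end.
have gramE x y : x \in Y -> y \in Y -> \sum_(z in D) f x z * f y z
    = 2 * kernel x y + (if fib x == fib y then p else q).
  rewrite !inE => xt yt; rewrite sumD /= gE //; congr (_ + _).
  have sumF0 a : \sum_(y in F) kernel a y = 0.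
    by rewrite -[RHS](sum_kernel_eq0 a o); apply: eq_bigl => b; rewrite inE.
  rewrite (eq_bigr (fun z => 2 / s * ((kernel x z - c * kernel x x0)
      * (kernel y z - c * kernel y x0)))); last first.
    move=> z _; rewrite mulrACA -expr2 sqr_sqrtr //.
    by rewrite divr_ge0 // ltW.
  rewrite -mulr_sumr drop_coordinate //.
  rewrite (eq_bigl (fun z => fib z == o)); last by move=> z; rewrite inE.
  rewrite kernel_reproducing //; field.
  by rewrite gt_eqF.
rewrite -cardY -cardD; apply: (@equiangular_of_gram _ _ _ _ _ f (1 + 2 * s) 1).
- exact: ler01.
- lra.
- by move=> x xY; rewrite gramE // /kernel !eqxx /p /=; field.
move=> x y xY yY nxy; rewrite gramE // /kernel (negbTE nxy) /p /q /=.
have [_|_] := eqVneq (fib x) (fib y).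
  by rewrite [X in `|X|](_ : _ = 1) ?normr1 //; field.
case: (adj x y) => /=; first by rewrite [X in `|X|](_ : _ = 1) ?normr1 //; field.
by rewrite [X in `|X|](_ : _ = -1) ?normrN1 //; field.
Qed.

(** Vertices of the fiber of x count in neither relation, and each of the other
    w - 1 fibers contributes k - (v - k). *)
Lemma valency_difference x :
  #|[set y | scheme_R1 (lssd_scheme fib adj) x y]|%:R
    - #|[set y | scheme_R3 (lssd_scheme fib adj) x y]|%:R
  = (w%:R - 1) * (2 * k%:R - v%:R) :> R.
Proof.
rewrite -!sum1_card !natr_sum [X in X - _]big_mkcond [X in _ - X]big_mkcond.
rewrite -sumrB.
rewrite (partition_big fib predT) //= (bigD1 (fib x)) //=.
rewrite big1 ?add0r; last first.
  move=> y /eqP yx; rewrite !inE /scheme_R1 /scheme_R3 /lssd_scheme /=.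
  rewrite /multipartite_complement yx eqxx /=.
  by rewrite (negbTE (lssd_fiber_indep hlssd (esym yx))) subrr.
rewrite (eq_bigr (fun=> 2 * k%:R - v%:R)); last first.
  move=> h hx; rewrite eq_sym in hx.
  rewrite -(sum_adj hx) -(sum_fiber1 h) mulr_sumr -sumrB.
  apply: eq_bigr => y /eqP yh; rewrite !inE /scheme_R1 /scheme_R3 /lssd_scheme /=.
  rewrite /multipartite_complement yh hx /=.
  by case: adj => /=; ring.
rewrite sumr_const cardC1 card_ord -[LHS]mulr_natl -subn1 natrB //.
exact: ltnW (lssd_fibers_ge2 hlssd).
Qed.

Lemma optimisticE : optimistic (lssd_scheme fib adj) -> v%:R < 2 * k%:R :> R.
Proof.
have [x _] := fiber_inhabited (Ordinal (ltnW (lssd_fibers_ge2 hlssd))).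
move=> /(_ x); rewrite -(ltr_nat R) -subr_gt0 valency_difference.
by rewrite pmulr_rgt0 ?subr_gt0 // ltr1n (lssd_fibers_ge2 hlssd).
Qed.

Lemma pessimisticE : pessimistic (lssd_scheme fib adj) -> 2 * k%:R < v%:R :> R.
Proof.
have [x _] := fiber_inhabited (Ordinal (ltnW (lssd_fibers_ge2 hlssd))).
move=> /(_ x); rewrite -(ltr_nat R) -subr_lt0 valency_difference.
by rewrite pmulr_rlt0 ?subr_lt0 // subr_gt0 ltr1n (lssd_fibers_ge2 hlssd).
Qed.

End LinkedSystem.

Lemma psd_of_le_bound (R : realType) (v k s t : R) : 2 * k < v ->
  t <= 2 + 2 * (k + s) / (v - 2 * k) ->
  0 <= 2 * s + v + (t - 1) * (2 * k - v).
Proof.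
move=> kv; rewrite -lerBlDl ler_pdivlMr; last by lra.
by move=> h; lra.
Qed.

Theorem theorem6p1 (R : realType) (X : finType) (w : nat) (fib : X -> 'I_w)
    (adj : rel X) (v k lam mu nu : nat)
    (hlssd : LSSD fib adj v k lam mu nu)
    (hnondeg : nondegenerate_lssd v k)
    (hheavy : mu_heavy w mu nu) :
  let L := lssd_scheme fib adj in
  let s : R := Num.sqrt (k%:R - lam%:R) in
  let bound : R := 2 + 2 * (k%:R + s) / (v%:R - 2 * k%:R) in
  (optimistic L \/ (pessimistic L /\ w%:R <= bound) ->
     forall t : nat, (1 <= t <= w)%N -> exists_equiangular R (v * t) (v + t - 1)) /\
  (pessimistic L /\ bound < w%:R ->
     forall t : nat, (1 <= t)%N -> t%:R <= bound ->
       exists_equiangular R (v * t) (v + t - 1)).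
Proof.
move=> L s bound; split=> [hyp t htw|[pess hw] t t1 htb]; last first.
  apply: (lssd_equiangular hlssd) => //.
    by rewrite t1 -(ler_nat R) (le_trans htb) // ltW.
  exact: psd_of_le_bound (pessimisticE hlssd hnondeg pess) htb.
apply: (lssd_equiangular hlssd) => //; case/andP: htw => t1 tw.
case: hyp => [/(optimisticE (R := R) hlssd hnondeg) opt|[pess hw]].
  rewrite addr_ge0 ?addr_ge0 ?mulr_ge0 ?sqrtr_ge0 ?ler0n ?subr_ge0 ?ler1n //.
  exact: ltW.
apply: psd_of_le_bound (pessimisticE hlssd hnondeg pess) (le_trans _ hw).
by rewrite ler_nat.
Qed.
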